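(* Let $(M,F)$ be a conic pseudo-Finsler surface with $F$ defined on the conic sub-bundle $\mathcal A$, let $\phi:\mathcal A\to\mathbb R$ be a smooth function positively homogeneous of degree $0$ in $y$, and let $\overline F=e^{\phi}F$. Put $\sigma=\phi_{;2;2}+\varepsilon\mathcal I\phi_{;2}+2(\phi_{;2})^2$, assume $\sigma+\varepsilon-(\phi_{;2})^2\neq0$ on $\mathcal A$, and put $\rho=\dfrac1{\sigma+\varepsilon-(\phi_{;2})^2}$. Then the inverse $(\overline g^{ij})$ of the matrix $\overline g_{ij}=\tfrac12\dot\partial_i\dot\partial_j\overline F^2$ is given by $$\overline g^{ij}=e^{-2\phi}\big[\varepsilon\rho\, g^{ij}+\sigma\rho\,\ell^i\ell^j-\varepsilon\phi_{;2}\,\rho(\ell^im^j+\ell^jm^i)\big]$$ $$\phantom{\overline g^{ij}}=e^{-2\phi}\big[g^{ij}+(\phi_{;2})^2\rho\,\ell^i\ell^j-\varepsilon\phi_{;2}\,\rho(\ell^im^j+\ell^jm^i)+(\rho-\varepsilon)m^im^j\big].$$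
   Context: Let $M$ be a smooth 2-dimensional manifold, $(x^1,x^2)$ local coordinates and $(x^i,y^i)$ the induced coordinates on $TM$; all formulas are in such a coordinate system and repeated indices are summed over $\{1,2\}$. Write $\dot\partial_i=\partial/\partial y^i$. A function is $h(r)$ if it is positively homogeneous of degree $r$ in $y$. A conic sub-bundle is a non-empty open subset $\mathcal A\subset TM\setminus 0$ projecting onto $M$ and closed under multiplication by positive scalars. A conic pseudo-Finsler metric on $M$ is a smooth $h(1)$ function $F:\mathcal A\to\mathbb R$ such that $g_{ij}=\tfrac12\dot\partial_i\dot\partial_jF^2$ is non-degenerate at each point of $\mathcal A$; $(g^{ij})$ is the inverse matrix. A conic pseudo-Finsler surface is equipped with its modified Berwald frame: $F$ is nowhere zero on $\mathcal A$, $\ell_i=\dot\partial_iF$, $\ell^i=y^i/F$, $\varepsilon\in\{1,-1\}$ (the signature) is the sign of $\det(g_{ij})$, $m_1=-\sqrt{\varepsilon\det(g_{ij})}\,\ell^2$, $m_2=\sqrt{\varepsilon\det(g_{ij})}\,\ell^1$, $m^i=g^{ij}m_j$; thus $g_{ij}=\ell_i\ell_j+\varepsilon m_im_j$, $g^{ij}=\ell^i\ell^j+\varepsilon m^im^j$, $\ell^im_i=0$, $m^im_i=\varepsilon$. The main scalar $\mathcal I$ is defined by $F\,C_{ijk}=\mathcal I\,m_im_jm_k$, where $C_{ijk}=\tfrac12\dot\partial_kg_{ij}$. For a smooth function $f$ on $\mathcal A$, $f_{;2}:=\varepsilon F(\dot\partial_if)m^i$ and $f_{;2;2}:=(f_{;2})_{;2}$.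 *)

(* Defs.v *)
From mathcomp Require Import all_boot all_order all_algebra.
From mathcomp Require Import all_classical all_reals all_analysis.

Set Implicit Arguments.
Unset Strict Implicit.
Unset Printing Implicit Defensive.

Import Order.TTheory GRing.Theory Num.Theory.
Import numFieldNormedType.Exports.

Local Open Scope classical_set_scope.
Local Open Scope ring_scope.

(** * Smooth maps on open subsets of normed spaces *)

(* C^k on an open set [D] of a finite-dimensional space; the values of [f]
   outside [D] are irrelevant because [D] is open. *)
Fixpoint Ck (R : realType) (V W : normedModType R) (k : nat)
    (D : set V) (f : V -> W) : Prop :=
  match k with
  | 0 => forall p, D p -> {for p, continuous f}
  | k'.+1 => (forall p, D p -> differentiable f p) /\
             (forall v, Ck k' D ('D_v f))
  end.

Definition smooth_on (R : realType) (V W : normedModType R)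
    (D : set V) (f : V -> W) : Prop := forall k, Ck k D f.

(** * Smooth surfaces and their tangent bundle *)

(* A Hausdorff second countable space with a smooth 2-dimensional atlas (any
   smooth atlas, for instance the maximal one). [param i] is the inverse of
   [chart i]; both are total functions, meaningful on [dom i] and on
   [img i = chart i @` dom i] respectively. *)
Record smoothSurface (R : realType) := SmoothSurface {
  carrier :> topologicalType ;
  chart_index : Type ;
  dom : chart_index -> set carrier ;
  chart : chart_index -> carrier -> 'rV[R]_2 ;
  param : chart_index -> 'rV[R]_2 -> carrier ;
  surface_hausdorff : hausdorff_space carrier ;
  surface_second_countable : @second_countable carrier ;
  dom_open : forall i, open (dom i) ;
  dom_cover : forall p, exists i, dom i p ;
  img_open : forall i, open (chart i @` dom i) ;
  chartK : forall i p, dom i p -> param i (chart i p) = p ;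
  chart_continuous : forall i p, dom i p -> {for p, continuous (chart i)} ;
  param_continuous : forall i x, (chart i @` dom i) x ->
    {for x, continuous (param i)} ;
  transition_smooth : forall i j,
    smooth_on (chart i @` (dom i `&` dom j)) (chart j \o param i)
}.

Section TangentBundle.
Variables (R : realType) (M : smoothSurface R).

Local Notation coord := ('rV[R]_2 * 'rV[R]_2)%type.
Local Notation idx := (chart_index M).

Definition img (i : idx) : set 'rV[R]_2 := chart i @` dom i.

(* A tangent vector is identified with the set of all its coordinate
   expressions [(j, (x, y))]; this is the set containing [(i, z)], i.e. the
   equivalence class of [(i, z)] under changes of charts
   [x' = tau x, y' = d tau_x (y)] with [tau = chart j \o param i]. *)
Definition tvec (i : idx) (z : coord) : set (idx * coord) :=
  [set jw : idx * coord | [/\ img i z.1, img jw.1 jw.2.1,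
                param i z.1 = param jw.1 jw.2.1 &
                jw.2.2 = 'd (chart jw.1 \o param i) (z.1) z.2]].

Lemma param_dom (i : chart_index M) x : img i x -> dom i (param i x) /\ chart i (param i x) = x.
Proof. by case=> p ip <-; rewrite chartK. Qed.

Lemma near_overlap (i j : chart_index M) x : img i x -> dom j (param i x) ->
  \forall y \near x, img i y /\ dom j (param i y).
Proof.
move=> ix jx; near=> y; split; near: y.
  by move: (@img_open _ M i); rewrite openE => /(_ _ ix).
apply: (param_continuous ix).
by move: (@dom_open _ M j); rewrite openE => /(_ _ jx).
Unshelve. all: by end_near. Qed.

Lemma trans_diff (i j : chart_index M) x : img i x -> dom j (param i x) ->
  differentiable (chart j \o param i) x.
Proof.
move=> ix jx; have [h _] := @transition_smooth _ M i j 1; apply: h.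
by have [d c] := param_dom ix; exists (param i x).
Qed.

Lemma trans_cocycle (i j k : chart_index M) x v :
  img i x -> dom j (param i x) -> dom k (param i x) ->
  'd (chart k \o param j) (chart j (param i x)) ('d (chart j \o param i) x v)
  = 'd (chart k \o param i) x v.
Proof.
move=> ix jx kx.
have imj : img j (chart j (param i x)) by exists (param i x).
have dj : differentiable (chart j \o param i) x by exact: trans_diff.
have dk : differentiable (chart k \o param j) ((chart j \o param i) x).
  by apply: trans_diff => //=; rewrite chartK.
have dik : differentiable (chart k \o param i) x by exact: trans_diff.
have dc : differentiable ((chart k \o param j) \o (chart j \o param i)) x.
  exact: differentiable_comp.
transitivity ('d ((chart k \o param j) \o (chart j \o param i)) x v).
  by have /(congr1 (fun h => h v)) := diff_comp dj dk.
refine (etrans (esym (deriveE v dc)) (etrans _ (deriveE v dik))).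
apply: near_eq_derive.
near=> y => /=.
have [iy jy] : img i y /\ dom j (param i y).
  by near: y; exact: (near_overlap ix jx).
by rewrite (chartK jy).
Unshelve. all: by end_near. Qed.

Lemma trans_id (i : chart_index M) x v : img i x -> 'd (chart i \o param i) x v = v.
Proof.
move=> ix; have [dx cx] := param_dom ix.
have d := trans_diff ix dx.
refine (etrans (esym (deriveE v d)) _).
transitivity ('D_v (@id 'rV[R]_2) x); last exact: derive_id.
apply: near_eq_derive.
near=> y => /=.
have [iy jy] : img i y /\ dom i (param i y).
  by near: y; exact: (near_overlap ix dx).
by have [] := param_dom iy.
Unshelve. all: by end_near. Qed.

Lemma tvec_refl (i : chart_index M) z : img i z.1 -> tvec i z (i, z).
Proof. by move=> iz; split => //=; rewrite (trans_id _ iz). Qed.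

(* Two coordinate expressions give the same tangent vector iff they are
   related by the tangent map of the change of charts. *)
Lemma tvecP (i j : chart_index M) z w : img i z.1 -> img j w.1 ->
  tvec i z (j, w) <-> tvec i z = tvec j w.
Proof.
move=> iz jw; split; last by move=> ->; exact: tvec_refl.
case=> /= _ _ pe we; have [diz cz] := param_dom iz; have [djw cw] := param_dom jw.
have H k u : img k u -> param i z.1 = param k u ->
  'd (chart k \o param j) (w.1) w.2 = 'd (chart k \o param i) (z.1) z.2.
  move=> ku e; rewrite we -cw -pe; apply: trans_cocycle => //; first by rewrite pe.
  by rewrite e; have [] := param_dom ku.
apply/seteqP; split => -[k u] [/= _ ku e ue].
- split => //=; first exact: (etrans (esym pe) e).
  exact: (etrans ue (esym (H _ _ ku e))).
- have e' := etrans pe e.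
  exact: (And4 iz ku e' (etrans ue (H _ _ ku e'))).
Qed.

(* Functions "on" a subset of [TM] below are total functions on the ambient
   type [tangent]; only their values on that subset matter. *)
Definition tangent := set (idx * coord).

(* The complement of the zero section in TM. *)
Definition TM0 : set tangent :=
  [set u | exists i z, [/\ img i z.1, z.2 != 0 & u = tvec i z]].

Definition local_set (A : set tangent) (i : idx) : set coord :=
  [set z | img i z.1 /\ A (tvec i z)].

(* Expression of a function on (a subset of) TM in the induced coordinates
   (x^1, x^2, y^1, y^2) of the chart [i]. *)
Definition local_fun (f : tangent -> R) (i : idx) : coord -> R :=
  fun z => f (tvec i z).

Definition TM_open (A : set tangent) : Prop :=
  forall i, open (local_set A i).

Definition TM_smooth (A : set tangent) (f : tangent -> R) : Prop :=
  forall i, smooth_on (local_set A i) (local_fun f i).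

(* h(r): f (t u) = t^r f(u) for all t > 0 *)
Definition homogeneous (A : set tangent) (r : R) (f : tangent -> R) : Prop :=
  forall i x y (t : R), 0 < t -> local_set A i (x, y) ->
    local_fun f i (x, t *: y) = t `^ r * local_fun f i (x, y).

Record conic_subbundle (A : set tangent) : Prop := ConicSubbundle {
  conic_TM0 : A `<=` TM0 ;
  conic_nonempty : A !=set0 ;
  conic_open : TM_open A ;
  conic_onto : forall p : M, exists i z,
    [/\ local_set A i z & param i z.1 = p] ;
  conic_scale : forall i x y (t : R), 0 < t ->
    local_set A i (x, y) -> local_set A i (x, t *: y)
}.

End TangentBundle.

(** * Geometric objects of a pseudo-Finsler surface, in induced coordinates

    Here [F] is the coordinate expression of the metric, [z = (x, y)]. The
    indices 1, 2 of the mathematical text are [0, 1 : 'I_2]. *)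

Section Local.
Variable R : realType.
Local Notation coord := ('rV[R]_2 * 'rV[R]_2)%type.
Implicit Types (F f : coord -> R) (i j k : 'I_2) (z : coord).

(* \dot\partial_i = \partial / \partial y^i *)
Definition dy i f : coord -> R := 'D_((0, delta_mx 0 i) : coord) f.

Definition gmet F z : 'M[R]_2 :=
  \matrix_(i, j) (2^-1 * dy i (dy j (fun w => F w ^+ 2)) z).

Definition ginv F z : 'M[R]_2 := invmx (gmet F z).

Definition cartan F i j k z : R := 2^-1 * dy k (fun w => gmet F w i j) z.

(* The sign of det g, taken pointwise. *)
Definition signature F z : R := Num.sg (\det (gmet F z)).

Definition l_lo F i z : R := dy i F z.

Definition l_up F i z : R := z.2 0 i / F z.

Definition m_lo F i z : R :=
  let s := Num.sqrt (signature F z * \det (gmet F z)) in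
  if i == 0 then - s * l_up F 1 z else s * l_up F 0 z.

Definition m_up F i z : R := \sum_j ginv F z i j * m_lo F j z.

(* The scalar I such that F C_ijk = I m_i m_j m_k. *)
Definition main_scalar F z : R :=
  xget 0 [set c : R | forall i j k,
    F z * cartan F i j k z = c * m_lo F i z * m_lo F j z * m_lo F k z].

(* f_{;2} *)
Definition vder2 F f z : R :=
  signature F z * F z * \sum_i dy i f z * m_up F i z.

(* sigma = phi_{;2;2} + eps I phi_{;2} + 2 (phi_{;2})^2 *)
Definition sigma F f z : R :=
  vder2 F (vder2 F f) z + signature F z * main_scalar F z * vder2 F f z
  + 2 * vder2 F f z ^+ 2.

(* 1 / rho *)
Definition rho_denom F f z : R :=
  sigma F f z + signature F z - vder2 F f z ^+ 2.

Definition rho F f z : R := 1 / rho_denom F f z.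

End Local.

(** * Conic pseudo-Finsler surfaces *)

(* The last condition is required for the modified Berwald frame. *)
Record conic_pseudo_Finsler (R : realType) (M : smoothSurface R)
    (A : set (tangent M)) (F : tangent M -> R) : Prop := ConicPseudoFinsler {
  Finsler_conic : conic_subbundle A ;
  Finsler_smooth : TM_smooth A F ;
  Finsler_homogeneous : homogeneous A 1 F ;
  Finsler_nondegenerate : forall i z, local_set A i z ->
    \det (gmet (local_fun F i) z) != 0 ;
  Finsler_neq0 : forall u, A u -> F u != 0
}.

(* Main.v *)
Require Import Defs.
From mathcomp Require Import all_boot all_order all_algebra.
From mathcomp Require Import all_classical all_reals all_analysis.
From mathcomp Require Import ring.

Set Implicit Arguments.
Unset Strict Implicit.
Unset Printing Implicit Defensive.
Set SsrHave NoTCResolution.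

Import Order.TTheory GRing.Theory Num.Theory.
Import numFieldNormedType.Exports.

Local Open Scope classical_set_scope.
Local Open Scope ring_scope.

(** Write [n = (- y^2, y^1)], [D = det g] and [s = sqrt |D|], so that
    [m_i = s n_i / F]. In dimension 2 a function [f] that is h(0) satisfies
    [y^i f_i = 0] (Euler), so its vertical gradient is a multiple of [n]:
    [F f_i = (F_1 f_2 - F_2 f_1) n_i]. Applied to [F_i], [phi] and [D] this gives
    [F^3 F_ij = D n_i n_j], [F^2 phi_i = P n_i] with [P = s phi_{;2}], and
    [2 F^2 C_ijk = D_k n_i n_j]. Differentiating the second identity once more,
    [e^{-2 phi} gbar_ij] becomes a quadratic form in the coframe [(F_i, n_i)]
    with coefficients [1], [P / F], [(2 P^2 + Q F + D) / F^2] where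
    [F P_k = Q n_k]; since [phi_{;2} = P / s], the derivative of [s] contributes
    to [phi_{;2;2}] exactly the term cancelled by [eps I phi_{;2}], so that
    [sigma s^2 = F Q + 2 P^2]. The form is inverted in the dual frame.
    Euler's identity, used in both slots, makes the second vertical derivatives
    symmetric without Schwarz's theorem. *)

(** * Algebra of two-dimensional frames *)

(** A quarter turn. It sends a vector to a covector annihilating it and a covector to a vector in
    its kernel, so it is applied both to [y] and to the components of [dy i F]. *)
Definition perp (R : pzRingType) (u : 'I_2 -> R) (i : 'I_2) : R :=
  if i == 0 then - u 1 else u 0.

Lemma ord2P (P : 'I_2 -> Prop) : P 0 -> P 1 -> forall i, P i.
Proof.
move=> P0 P1 [[|[|//]] hi].
- by rewrite (_ : Ordinal hi = 0) //; exact: val_inj.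
- by rewrite (_ : Ordinal hi = 1) //; exact: val_inj.
Qed.

Lemma sum_ord2 (V : nmodType) (f : 'I_2 -> V) : \sum_i f i = f 0 + f 1.
Proof.
by rewrite big_ord_recl big_ord1; congr (_ + f _); exact: val_inj.
Qed.

Lemma det_mx22 (R : comPzRingType) (M : 'M[R]_2) :
  \det M = M 0 0 * M 1 1 - M 0 1 * M 1 0.
Proof.
rewrite (expand_det_row _ 0) sum_ord2 /cofactor !det_mx11 !mxE /=.
have e0 : lift 0 0 = 1 :> 'I_2 by exact: val_inj.
have e1 : lift 1 0 = 0 :> 'I_2 by exact: val_inj.
by rewrite e0 e1 addn0 expr0 expr1 mul1r mulN1r mulrN.
Qed.

(* [(u, perp f)] is, up to the factor [f 0 * u 0 + f 1 * u 1], the frame dual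
   to the coframe [(f, perp u)]. *)
Lemma frame_invmx (R : fieldType) (f u : 'I_2 -> R) (a b c : R) (M : 'M[R]_2) :
  f 0 * u 0 + f 1 * u 1 != 0 -> a * c - b ^+ 2 != 0 ->
  (forall i j, M i j = a * f i * f j + b * (f i * perp u j + f j * perp u i)
                       + c * perp u i * perp u j) ->
  M \in unitmx /\
  forall i j, invmx M i j =
    (c * u i * u j - b * (u i * perp f j + u j * perp f i)
     + a * perp f i * perp f j)
    / ((f 0 * u 0 + f 1 * u 1) ^+ 2 * (a * c - b ^+ 2)).
Proof.
move=> L0 d0 ME.
pose X : 'M[R]_2 := \matrix_(i, j)
    ((c * u i * u j - b * (u i * perp f j + u j * perp f i)
     + a * perp f i * perp f j)
    / ((f 0 * u 0 + f 1 * u 1) ^+ 2 * (a * c - b ^+ 2))).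
have MX : M *m X = 1%:M.
  apply/matrixP; apply: ord2P; apply: ord2P;
    rewrite !mxE sum_ord2 !mxE !ME /perp /=; field; exact/andP.
have [Mu _] := mulmx1_unit MX.
split=> // i j; rewrite -[invmx M]mulmx1 -MX mulKmx //.
by rewrite mxE.
Qed.

(** In dimension 2 the covectors annihilating [u] are the multiples of [perp u]; the coefficient is
    found by pairing with [perp f]. *)
Lemma euler0_perp (R : comPzRingType) (f u d : 'I_2 -> R) :
  u 0 * d 0 + u 1 * d 1 = 0 ->
  forall i, (f 0 * u 0 + f 1 * u 1) * d i = (f 0 * d 1 - f 1 * d 0) * perp u i.
Proof.
move=> h; apply: ord2P; rewrite /perp /=.
- transitivity (f 0 * (u 0 * d 0 + u 1 * d 1) + (f 0 * d 1 - f 1 * d 0) * - u 1).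
    by ring.
  by rewrite h; ring.
- transitivity (f 1 * (u 0 * d 0 + u 1 * d 1) + (f 0 * d 1 - f 1 * d 0) * u 0).
    by ring.
  by rewrite h; ring.
Qed.

Lemma sum_ord2_delta (R : pzRingType) (f : 'I_2 -> R) j :
  f 0 * (0 == j)%:R + f 1 * (1 == j)%:R = f j.
Proof. by elim/ord2P: j; rewrite /= mulr0 mulr1 ?addr0 ?add0r. Qed.

Section PerpAlgebra.
Variables (K : fieldType) (f y : 'I_2 -> K).
Local Notation L := (f 0 * y 0 + f 1 * y 1).
Hypothesis L_neq0 : L != 0.

(** [euler0_perp] is applied to the first index of [H], then to the second. This leaves one scalar
    [V], which the determinant of [g] identifies as det g / L. *)
Lemma euler0_hess (H : 'I_2 -> 'I_2 -> K) :
  (forall j, y 0 * H 0 j + y 1 * H 1 j = 0) ->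
  (forall j, y 0 * H j 0 + y 1 * H j 1 = 0) ->
  let g i j := f i * f j + L * H i j in
  forall i j, L ^+ 3 * H i j =
    (g 0 0 * g 1 1 - g 0 1 * g 1 0) * perp y i * perp y j.
Proof.
move=> Hl Hr g.
(* [W] is the coefficient left by the first index; as a covector in [j] it annihilates [y] too. *)
pose W j := f 0 * H 1 j - f 1 * H 0 j.
have HE i j : L * H i j = W j * perp y i.
  exact: (@euler0_perp _ f y (fun i => H i j)).
have WE j : L * W j = (f 0 * W 1 - f 1 * W 0) * perp y j.
  apply: euler0_perp; rewrite /W.
  transitivity (f 0 * (y 0 * H 1 0 + y 1 * H 1 1)
    - f 1 * (y 0 * H 0 0 + y 1 * H 0 1)); first by ring.
  by rewrite !Hr !mulr0 subrr.
set V := f 0 * W 1 - f 1 * W 0 in WE.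
have E i j : H i j = V * perp y i * perp y j / L ^+ 2.
  apply: (mulfI (expf_neq0 2 L_neq0)); rewrite mulrCA divff ?expf_neq0 // mulr1.
  by rewrite expr2 -mulrA HE mulrA WE; ring.
have DE : g 0 0 * g 1 1 - g 0 1 * g 1 0 = L * V.
  by rewrite /g !E /perp /=; field.
by move=> i j; rewrite DE E; field.
Qed.

(* The contraction [g^{ij} m_j], with [d = det g] and [m = s * perp y / F]. *)
Lemma perp_contract (s d : K) i : s != 0 -> d != 0 ->
  \sum_j (d / L ^+ 2 * y i * y j + perp f i * perp f j) / d * (s * perp y j / L)
  = s * perp f i / d.
Proof.
move=> s0 d0; rewrite sum_ord2 /perp /=; field.
exact/andP.
Qed.

End PerpAlgebra.

(** [perp y] is linear in [y], so its derivative in the [k]-th fibre direction is [perp] of a basis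
    vector; here that derivative is expanded in the coframe [(f, perp y)]. *)
Lemma perp_delta (R : comPzRingType) (f y : 'I_2 -> R) k i :
  (f 0 * y 0 + f 1 * y 1) * perp (fun l => (l == k)%:R) i
  = f k * perp y i - f i * perp y k.
Proof. by elim/ord2P: i; elim/ord2P: k; rewrite /perp /=; ring. Qed.

Lemma perp_pairing (R : comPzRingType) (f y : 'I_2 -> R) :
  f 0 * perp y 1 - f 1 * perp y 0 = f 0 * y 0 + f 1 * y 1.
Proof. by rewrite /perp /=; ring. Qed.

(** Dictionary: [x] is e^phi, [S] is sqrt |det g|, [L] is F, [e] the signature, [p] is phi_{;2}, [s]
    is sigma, and [ki], [kj] are components of [perp] of the gradient of F, so that m^i = e ki / S.
    [h] is the inverse given by [frame_invmx] for the conformal metric. *)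
Lemma conformal_inverse_algebra (K : fieldType) (e p s x S L yi yj ki kj : K) :
  e ^+ 2 = 1 -> s + e - p ^+ 2 != 0 -> x != 0 -> S != 0 -> L != 0 ->
  let r := 1 / (s + e - p ^+ 2) in
  let g := (e * S ^+ 2 / L ^+ 2 * yi * yj + ki * kj) / (e * S ^+ 2) in
  let lm := yi / L * (e * kj / S) + yj / L * (e * ki / S) in
  let h := (x ^+ 2 * (2 * (p * S) ^+ 2 + (s - 2 * p ^+ 2) * S ^+ 2 + e * S ^+ 2)
              / L ^+ 2 * yi * yj
            - x ^+ 2 * (p * S) / L * (yi * kj + yj * ki) + x ^+ 2 * ki * kj)
           / (L ^+ 2 * (x ^+ 4 * S ^+ 2 * (s + e - p ^+ 2) / L ^+ 2)) in
  h = x ^- 2 * (e * r * g + s * r * (yi / L) * (yj / L) - e * p * r * lm) /\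
  h = x ^- 2 * (g + p ^+ 2 * r * (yi / L) * (yj / L) - e * p * r * lm
                + (r - e) * (e * ki / S) * (e * kj / S)).
Proof.
(* [field] cannot use the relation e^2 = 1, so the two signs are treated separately. *)
move=> /eqP; rewrite sqrf_eq1 => /orP[]/eqP-> d0 x0 S0 L0 r g lm h;
  by split; rewrite /h /lm /g /r; field; rewrite ?x0 ?S0 ?L0 ?d0 ?oppr_eq0 ?oner_eq0.
Qed.

(** * Directional derivatives and homogeneous functions *)

Section DirectionalDerivatives.
Variables (R : realType) (V : normedModType R).
Implicit Types (f g : V -> R) (z v : V).

(** Restriction to the line through [z] turns directional derivatives into derivatives at 0 of one
    real variable, where the usual chain rule applies. *)
Lemma is_derive_slice f z v (d : R) :
  is_derive z v f d <-> is_derive (0 : R) 1 (fun h : R => f (h *: v + z)) d.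
Proof.
have E : 'D_v f z = 'D_1 (fun h : R => f (h *: v + z)) 0.
  rewrite /derive; congr (lim (_ @ 0^')); apply/funext => h /=.
  by rewrite addr0 scale0r add0r [_%:A]mulr1.
split=> -[df <-]; apply: DeriveDef; rewrite -?E //; exact/(derivable1P f z v).
Qed.

Lemma is_derive_scalar_comp (h : R -> R) f z v (a b : R) :
  is_derive (f z) 1 h a -> is_derive z v f b ->
  is_derive z v (fun w => h (f w)) (a * b).
Proof.
move=> dh /is_derive_slice df; apply/is_derive_slice.
by apply: (@is_derive1_comp _ h (fun t : R => f (t *: v + z)));
  rewrite ?scale0r ?add0r.
Qed.

Lemma is_derive_const z v (c : R) : is_derive z v (fun _ => c) 0.
Proof. exact: is_derive_cst. Qed.

Lemma is_derive_mul f g z v (df dg : R) :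
  is_derive z v f df -> is_derive z v g dg ->
  is_derive z v (fun w => f w * g w) (f z * dg + g z * df).
Proof. by move=> hf hg; exact: is_deriveM. Qed.

Lemma is_derive_add f g z v (df dg : R) :
  is_derive z v f df -> is_derive z v g dg ->
  is_derive z v (fun w => f w + g w) (df + dg).
Proof. by move=> hf hg; exact: is_deriveD. Qed.

Lemma is_derive_opp f z v (df : R) :
  is_derive z v f df -> is_derive z v (fun w => - f w) (- df).
Proof. by move=> hf; exact: is_deriveN. Qed.

(** The device for differentiating an identity that holds on an open set: each side is derived by
    its own rules and the results agree. *)
Lemma is_derive_inj (U : set V) f g z v (df dg : R) :
  open U -> U z -> (forall w, U w -> f w = g w) ->
  is_derive z v f df -> is_derive z v g dg -> df = dg.
Proof.
move=> Uo Uz fg [_ <-] [_ <-]; apply: near_eq_derive.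
by near do apply: fg; exact: open_nbhs_nbhs.
Unshelve. all: by end_near. Qed.

Lemma is_derive_open (U : set V) f g z v (df : R) :
  open U -> U z -> (forall w, U w -> f w = g w) ->
  is_derive z v f df -> is_derive z v g df.
Proof.
move=> Uo Uz fg; apply: near_eq_is_derive.
by near do apply: fg; exact: open_nbhs_nbhs.
Unshelve. all: by end_near. Qed.

Lemma is_derive_of_differentiable f z v :
  differentiable f z -> is_derive z v f ('D_v f z).
Proof. by move=> df; exact/derivableP/diff_derivable. Qed.

Lemma smooth_on_derive (U : set V) f v : smooth_on U f -> smooth_on U ('D_v f).
Proof. by move=> sf k; have [_] := sf k.+1; exact. Qed.

Lemma smooth_on_differentiable (U : set V) f z :
  smooth_on U f -> U z -> differentiable f z.
Proof. by move=> /(_ 1) [df _]; exact: df. Qed.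

End DirectionalDerivatives.

(** Writing the function as a power of the square removes the absolute value, so one differentiation
    rule covers both signs of [x]. *)
Lemma inv_sqrt_norm_powR (R : realType) (x : R) :
  (Num.sqrt `|x|)^-1 = (x * x) `^ (- 4^-1).
Proof.
rewrite powRN -(sqrtr_sqr x) -expr2 -!powR12_sqrt ?powR_ge0 ?sqr_ge0 // -powRrM.
by congr (_ `^ _)^-1; field.
Qed.

Lemma is_derive_inv_sqrt_norm (R : realType) (V : normedModType R)
    (f : V -> R) z v (d : R) :
  f z != 0 -> is_derive z v f d ->
  is_derive z v (fun w => (Num.sqrt `|f w|)^-1)
    (- d / (2 * f z * Num.sqrt `|f z|)).
Proof.
move=> f0 df; have ff0 : 0 < f z * f z by rewrite -expr2 exprn_even_gt0.
have -> : (fun w => (Num.sqrt `|f w|)^-1) = (fun w => (f w * f w) `^ (- 4^-1)).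
  by apply/funext => w; rewrite inv_sqrt_norm_powR.
have -> : - d / (2 * f z * Num.sqrt `|f z|)
    = - 4^-1 * (f z * f z) `^ (- 4^-1 - 1) * (f z * d + f z * d).
  rewrite powRB; last by rewrite (gt_eqF ff0) implybT.
  have s0 : Num.sqrt `|f z| != 0 by rewrite gt_eqF // sqrtr_gt0 normr_gt0.
  rewrite powRr1 ?ltW // -inv_sqrt_norm_powR.
  by move: s0; move: (Num.sqrt `|f z| : R) (f z : R) f0 => s x x0 s0; field; rewrite x0 s0.
exact: (is_derive_scalar_comp (h := fun x : R => x `^ (- 4^-1))
  (f := fun w => f w * f w) (is_derive1_powR (- 4^-1) ff0) (is_derive_mul df df)).
Qed.


(** * Homogeneity in the fibre variable and Euler's identity *)

Section Homogeneous.
Variable R : realType.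
Local Notation coord := ('rV[R]_2 * 'rV[R]_2)%type.
Local Notation ey k := ((0, delta_mx 0 k) : coord).
Implicit Types (f : coord -> R) (z w : coord) (r t : R).

Lemma near_line (V : normedModType R) (U : set V) x v : open U -> U x ->
  \forall h \near (0 : R), U (h *: v + x).
Proof.
move=> Uo Ux; have : {for (0 : R), continuous (fun h : R => h *: v + x)}.
  apply: differentiable_continuous.
  by apply: differentiableD => //; exact: differentiable_scalel.
apply; rewrite scale0r add0r; exact: open_nbhs_nbhs.
Qed.

Definition dilate t z : coord := (z.1, t *: z.2).

Variable U : set coord.
Hypothesis U_open : open U.
Hypothesis U_dilate : forall z t, 0 < t -> U z -> U (dilate t z).

Definition homog r f :=
  forall z t, 0 < t -> U z -> f (dilate t z) = t `^ r * f z.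

Lemma is_derive_y k i z :
  is_derive z (ey k) (fun w : coord => w.2 0 i) (i == k)%:R.
Proof.
apply/is_derive_slice.
have -> : (fun h : R => (h *: ey k + z).2 0 i)
        = (fun h : R => (i == k)%:R * h + z.2 0 i).
  by apply/funext => h; rewrite /= !mxE eqxx /= mulrC.
have := is_derive_add
  (is_derive_mul (is_derive_const (0 : R) 1 (i == k)%:R) (is_derive_id (0 : R) 1))
  (is_derive_const (0 : R) 1 (z.2 0 i)).
by rewrite mulr1 mulr0 !addr0.
Qed.

(** Both sides are the derivative of [f] along [(0, y)]: the left by linearity of the differential,
    the right by differentiating (1 + h)^r f(z) at h = 0. *)
Lemma euler r f z : homog r f -> U z -> differentiable f z ->
  z.2 0 0 * dy 0 f z + z.2 0 1 * dy 1 f z = r * f z.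
Proof.
move=> hf Uz df.
have zE : ((0, z.2) : coord) = z.2 0 0 *: ey 0 + z.2 0 1 *: ey 1.
  apply: injective_projections => /=; first by rewrite !scaler0 addr0.
  by apply/rowP; apply: ord2P; rewrite !mxE /= ?mulr1 ?mulr0 ?addr0 ?add0r.
transitivity ('D_((0, z.2) : coord) f z).
  by rewrite /dy !deriveE // zE linearD !linearZ.
have [_ <-] : is_derive z ((0, z.2) : coord) f (r * f z); last by [].
apply/is_derive_slice.
have lt01 : 0 < (0 + 1 : R) by rewrite add0r.
have := is_derive_mul
  (is_derive_scalar_comp (h := fun x : R => x `^ r) (f := fun x : R => x + 1) (is_derive1_powR r lt01)
     (is_derive_add (is_derive_id (0 : R) 1) (is_derive_const (0 : R) 1 1)))
  (is_derive_const (0 : R) 1 (f z)).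
rewrite add0r !powR1 mulr0 add0r addr0 !mulr1 mulrC; apply: near_eq_is_derive.
(* Homogeneity requires the dilation factor [h + 1] to be positive, which holds for [h] near 0. *)
near=> h; rewrite -hf //; last first.
  by rewrite -ltrBlDr sub0r; near: h; apply: lt_nbhsr; rewrite ltrN10.
congr f; apply: injective_projections => /=; first by rewrite scaler0 add0r.
by rewrite scalerDl scale1r.
Unshelve. all: by end_near. Qed.

(** A displacement by [h] at the dilated point is the dilation by [t] of a displacement by h / t at
    [z]; the chain rule then contributes the factor 1 / t. *)
Lemma homog_dy r f k : homog r f -> (forall w, U w -> differentiable f w) ->
  homog (r - 1) (dy k f).
Proof.
move=> hf df z t t0 Uz; rewrite /dy.
have dfz := is_derive_of_differentiable (ey k) (df _ Uz).
have := is_derive_of_differentiable (ey k) (df _ (U_dilate t0 Uz)).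
move=> /is_derive_slice[_ <-].
have [_ <-] : is_derive (0 : R) 1
    (fun h : R => t `^ r * f ((t^-1 * h) *: ey k + z))
    (t `^ (r - 1) * 'D_(ey k) f z); last first.
  apply: near_eq_derive.
  near=> h; rewrite -hf //.
    congr f; apply: injective_projections => /=; first by rewrite !scaler0.
    by rewrite scalerDr scalerA mulVKf // gt_eqF.
  by rewrite mulrC -scalerA; near: h; exact: near_line.
have {}dfz : is_derive (t^-1 * 0) 1 (fun x : R => f (x *: ey k + z)) ('D_(ey k) f z).
  by rewrite mulr0; move/is_derive_slice: dfz.
have := is_derive_mul (is_derive_const (0 : R) 1 (t `^ r))
  (is_derive_scalar_comp (f := fun h : R => t^-1 * h) dfz
     (is_derive_mul (is_derive_const (0 : R) 1 t^-1) (is_derive_id (0 : R) 1))).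
rewrite !mulr0 !addr0 mulr1 powRB; last by rewrite (gt_eqF t0) implybT.
by rewrite powRr1 ?ltW // mulrA mulrAC.
Unshelve. all: by end_near. Qed.

End Homogeneous.

(** * The Berwald frame of a pseudo-Finsler surface *)

Section MetricTensor.
Variables (R : realType) (U : set ('rV[R]_2 * 'rV[R]_2)%type).
Local Notation coord := ('rV[R]_2 * 'rV[R]_2)%type.
Local Notation ey k := ((0, delta_mx 0 k) : coord).
Hypothesis U_open : open U.

(** The product rule applied twice to G^2. The first derivatives are required on all of [U] because
    they are differentiated again. *)
Lemma gmet_derive (G : coord -> R) (G1 : 'I_2 -> coord -> R)
    (G2 : 'I_2 -> 'I_2 -> R) z :
  U z -> (forall j w, U w -> is_derive w (ey j) G (G1 j w)) ->
  (forall i j, is_derive z (ey i) (G1 j) (G2 i j)) ->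
  forall i j, gmet G z i j = G1 i z * G1 j z + G z * G2 i j.
Proof.
move=> Uz dG ddG i j; rewrite mxE.
have E w : U w -> G w * G1 j w + G w * G1 j w = dy j (fun w => G w ^+ 2) w.
  by move=> Uw; have [_ <-] := is_derive_mul (dG j w Uw) (dG j w Uw).
have := is_derive_mul (dG i z Uz) (ddG i j).
move=> h; have [_] := is_derive_open U_open Uz E (is_derive_add h h).
by rewrite /dy => ->; field.
Qed.

Lemma is_derive_dy (f : coord -> R) k z :
  differentiable f z -> is_derive z (ey k) f (dy k f z).
Proof. exact: is_derive_of_differentiable. Qed.

Lemma dyE (f : coord -> R) k z (d : R) : is_derive z (ey k) f d -> dy k f z = d.
Proof. by case. Qed.

Lemma smooth_on_dy (f : coord -> R) k : smooth_on U f -> smooth_on U (dy k f).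
Proof. exact: smooth_on_derive. Qed.

End MetricTensor.

(* Keeps [ring] and [field] from unfolding derivatives when they compare atoms. *)
#[local] Opaque dy.

(** * Euler relations for F, the metric tensor, its determinant and the frame *)

Section BerwaldFrame.
Variables (R : realType) (U : set ('rV[R]_2 * 'rV[R]_2)%type).
Local Notation coord := ('rV[R]_2 * 'rV[R]_2)%type.
Local Notation ey k := ((0, delta_mx 0 k) : coord).
Hypothesis U_open : open U.
Hypothesis U_dilate : forall z t, 0 < t -> U z -> U (dilate t z).
Variable F : coord -> R.
Hypothesis F_smooth : smooth_on U F.
Hypothesis F_homog : homog U 1 F.
Hypothesis F_neq0 : forall z, U z -> F z != 0.
Hypothesis F_nondeg : forall z, U z -> \det (gmet F z) != 0.

Local Notation yc i := (fun w : coord => w.2 0 i).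
Local Notation n i z := (perp (fun k => z.2 0 k) i).
Local Notation F1 i := (dy i F).
Local Notation F2 i j := (dy i (dy j F)).

Let dF z : U z -> differentiable F z.
Proof. exact: smooth_on_differentiable. Qed.

Let dF1 i z : U z -> differentiable (F1 i) z.
Proof. by apply: smooth_on_differentiable; exact: smooth_on_dy. Qed.

Let dF2 i j z : U z -> differentiable (F2 i j) z.
Proof. by apply: smooth_on_differentiable; do 2 apply: smooth_on_dy. Qed.

Let F1_homog i : homog U 0 (F1 i).
Proof.
have := homog_dy U_open U_dilate i F_homog dF.
by rewrite subrr.
Qed.

Let F2_homog i j : homog U (-1) (F2 i j).
Proof.
by have := homog_dy U_open U_dilate i (F1_homog j) (dF1 j); rewrite sub0r.
Qed.

Let F_euler z : U z -> F1 0 z * z.2 0 0 + F1 1 z * z.2 0 1 = F z.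
Proof.
move=> Uz; have := euler F_homog Uz (dF Uz).
by rewrite mul1r => <-; rewrite ![_ * dy _ _ _]mulrC.
Qed.

Let euler0 f z : homog U 0 f -> U z -> differentiable f z ->
  forall i, F z * dy i f z = (F1 0 z * dy 1 f z - F1 1 z * dy 0 f z) * n i z.
Proof.
move=> hf Uz df i; rewrite -(F_euler Uz).
apply: (@euler0_perp _ (fun i => F1 i z) (fun i => z.2 0 i) (fun i => dy i f z)).
by rewrite (euler hf Uz df) mul0r.
Qed.

(** Differentiating Euler's identity for F in direction [j] produces F_j on both sides, and what
    remains is the contraction of the Hessian in its inner slot. *)
Let F1_euler j z : U z -> z.2 0 0 * F2 j 0 z + z.2 0 1 * F2 j 1 z = 0.
Proof.
move=> Uz.
have := is_derive_inj U_open Uz F_euler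
 (is_derive_add
   (is_derive_mul (is_derive_dy j (dF1 0 Uz)) (is_derive_y j 0 z))
   (is_derive_mul (is_derive_dy j (dF1 1 Uz)) (is_derive_y j 1 z)))
 (is_derive_dy j (dF Uz)).
rewrite -(sum_ord2_delta (fun i => F1 i z) j).
rewrite addrACA -[RHS]addr0; exact: addrI.
Qed.

(** The metric coefficient written with derivatives of F rather than of F^2, in a form whose
    differentiability and homogeneity can be read off. *)
Definition gexp i j z : R := F1 i z * F1 j z + F z * F2 i j z.

Definition detg z : R := gexp 0 0 z * gexp 1 1 z - gexp 0 1 z * gexp 1 0 z.

Lemma gmetE i j z : U z -> gmet F z i j = gexp i j z.
Proof.
move=> Uz; apply: (gmet_derive U_open (G1 := fun j => F1 j)
  (G2 := fun i j => F2 i j z) Uz).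
- by move=> k w Uw; exact: is_derive_dy (dF Uw).
- by move=> k l; exact: is_derive_dy (dF1 l Uz).
Qed.

Lemma detgE z : U z -> \det (gmet F z) = detg z.
Proof. by move=> Uz; rewrite det_mx22 !gmetE. Qed.

Lemma hessF z : U z -> forall i j,
  F z ^+ 3 * F2 i j z = detg z * n i z * n j z.
Proof.
move=> Uz.
have L0 : F1 0 z * z.2 0 0 + F1 1 z * z.2 0 1 != 0 by rewrite F_euler // F_neq0.
(* The outer slot is Euler's identity for [dy k F], which has degree 0. *)
have Hl k : z.2 0 0 * F2 0 k z + z.2 0 1 * F2 1 k z = 0.
  by rewrite (euler (F1_homog k) Uz (dF1 k Uz)) mul0r.
move=> i j; have := @euler0_hess _ (fun k => F1 k z) (fun k => z.2 0 k) L0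
  (fun k l => F2 k l z) Hl (fun k => F1_euler k Uz) i j.
by rewrite F_euler.
Qed.

Lemma gexp_differentiable i j z : U z -> differentiable (gexp i j) z.
Proof.
by move=> Uz; apply: differentiableD; apply: differentiableM; auto.
Qed.

Lemma detg_differentiable z : U z -> differentiable detg z.
Proof.
move=> Uz; have dg i j := gexp_differentiable i j Uz.
by apply: differentiableB; apply: differentiableM; auto.
Qed.

Lemma detg_homog : homog U 0 detg.
Proof.
move=> z t t0 Uz.
have E i j : gexp i j (dilate t z) = gexp i j z.
  rewrite /gexp (F_homog t0 Uz) (F1_homog i t0 Uz) (F1_homog j t0 Uz).
  rewrite (F2_homog i j t0 Uz) powRr0 powRr1 ?ltW // powR_inv1 ?ltW //.
  by rewrite !mul1r mulrACA divff ?mul1r // gt_eqF.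
by rewrite /detg (E 0 0) (E 0 1) (E 1 0) (E 1 1) powRr0 mul1r.
Qed.

(** On [U] this is the factor sqrt(eps det g) of the modified Berwald frame. *)
Definition sdet z : R := Num.sqrt `|detg z|.

Lemma detg_neq0 z : U z -> detg z != 0.
Proof. by move=> Uz; rewrite -detgE // F_nondeg. Qed.

Lemma sdet_gt0 z : U z -> 0 < sdet z.
Proof. by move=> Uz; rewrite sqrtr_gt0 normr_gt0 detg_neq0. Qed.

Lemma signatureE z : U z -> signature F z = Num.sg (detg z).
Proof. by move=> Uz; rewrite /signature detgE. Qed.

Lemma detg_sdet z : U z -> detg z = signature F z * sdet z ^+ 2.
Proof.
by move=> Uz; rewrite sqr_sqrtr // signatureE // -numEsg.
Qed.

Lemma signature_sqr z : U z -> signature F z ^+ 2 = 1.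
Proof. by move=> Uz; rewrite signatureE // sqr_sg detg_neq0. Qed.

Lemma m_loE i z : U z -> m_lo F i z = sdet z * n i z / F z.
Proof.
move=> Uz; rewrite /m_lo detgE // signatureE // -normrEsg.
by rewrite /l_up /perp; case: ifP => _; rewrite ?mulrN ?mulNr mulrA.
Qed.

(** By [hessF] the metric has coefficients 1, 0, det g / F^2 in the coframe [(F_i, n_i)], so
    [frame_invmx] applies. *)
Lemma ginvE i j z : U z -> ginv F z i j =
  (detg z / F z ^+ 2 * z.2 0 i * z.2 0 j
   + perp (fun k => F1 k z) i * perp (fun k => F1 k z) j) / detg z.
Proof.
move=> Uz; have Fz := F_neq0 Uz; have Dz := detg_neq0 Uz.
have := @frame_invmx _ (fun k => F1 k z) (fun k => z.2 0 k) 1 0 (detg z / F z ^+ 2)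
  (gmet F z).
rewrite F_euler // => -[] //.
- by rewrite mul1r expr0n subr0 mulf_neq0 // invr_eq0 expf_neq0.
- move=> k l; rewrite gmetE // /gexp -[F2 k l z](mulKf (expf_neq0 3 Fz)) hessF //.
  move: (F1 k z) (F1 l z) (n k z) (n l z) (F z) (detg z) Fz => a b p q L d L0.
  by field.
- move=> _ h; rewrite [LHS]h; move: (perp _ i) (perp _ j) (z.2 0 i) (z.2 0 j).
  move: (detg z) (F z) Fz Dz => d L L0 d0 a b p q.
  by field; exact/andP.
Qed.

Lemma m_upE i z : U z ->
  m_up F i z = signature F z * perp (fun k => F1 k z) i / sdet z.
Proof.
move=> Uz; have Fz := F_neq0 Uz; have Dz := detg_neq0 Uz.
have sz := lt0r_neq0 (sdet_gt0 Uz).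
have L0 : F1 0 z * z.2 0 0 + F1 1 z * z.2 0 1 != 0 by rewrite F_euler.
have := @perp_contract _ (fun k => F1 k z) (fun k => z.2 0 k) L0 _ _ i sz Dz.
rewrite F_euler // => E; transitivity (sdet z * perp (fun k => F1 k z) i / detg z).
  by rewrite -E; apply: eq_bigr => j _; rewrite ginvE // m_loE.
have e2 := signature_sqr Uz; rewrite detg_sdet //; move: e2.
move: (signature F z) (sdet z) sz (perp _ i) => e s sz q e2.
have e0 : e != 0 by rewrite -sqrf_eq0 e2 oner_neq0.
(* The inserted e^2 = 1 turns the factor 1 / e coming from det g into e. *)
transitivity (e ^+ 2 * q / (e * s)); last by field; exact/andP.
by rewrite e2; field; exact/andP.
Qed.

Lemma vder2E f z : U z ->
  vder2 F f z = F z * (F1 0 z * dy 1 f z - F1 1 z * dy 0 f z) / sdet z.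
Proof.
move=> Uz; have sz := lt0r_neq0 (sdet_gt0 Uz).
rewrite /vder2 sum_ord2 !m_upE //.
transitivity (signature F z ^+ 2 * (F z * (F1 0 z * dy 1 f z - F1 1 z * dy 0 f z) / sdet z)).
  rewrite /perp /=; move: (signature F z) (F z) (F1 0 z) (F1 1 z) (sdet z) sz.
  by move=> e L a b s s0; move: (dy 0 f z) (dy 1 f z) => p q; field.
by rewrite signature_sqr // mul1r.
Qed.

(** * The Cartan tensor and the main scalar *)

Let is_derive_n k i z :
  is_derive z (ey k) (fun w => n i w) (perp (fun l => (l == k)%:R) i).
Proof.
rewrite /perp; case: ifP => _; last exact: is_derive_y.
exact: is_derive_opp (is_derive_y k 1 z).
Qed.

Let dn_perp k i z : U z ->
  F z * perp (fun l => (l == k)%:R) i = F1 k z * n i z - F1 i z * n k z.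
Proof.
move=> Uz; rewrite -(F_euler Uz).
exact: (@perp_delta _ (fun k => F1 k z) (fun k => z.2 0 k)).
Qed.

Lemma gexpE i j z : U z ->
  F z * F z * gexp i j z = F z * F z * (F1 i z * F1 j z) + detg z * (n i z * n j z).
Proof.
move=> Uz; rewrite [detg z * _]mulrA -(hessF Uz) /gexp.
by move: (F z) (F1 i z) (F1 j z) (F2 i j z) => a b c d; ring.
Qed.

#[local] Opaque gexp detg.

Lemma detg_euler k z : U z ->
  F z * dy k detg z = (F1 0 z * dy 1 detg z - F1 1 z * dy 0 detg z) * n k z.
Proof. by move=> Uz; apply: euler0 detg_homog Uz (detg_differentiable Uz) k. Qed.

(** The identity [gexpE] is differentiated in direction [k]. The Hessian of F and the derivatives of
    [n] cancel every term except the one carrying the derivative of det g. *)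
Lemma cartanE i j k z : U z ->
  F z * cartan F i j k z = (F1 0 z * dy 1 detg z - F1 1 z * dy 0 detg z)
    / (2 * F z ^+ 2) * n i z * n j z * n k z.
Proof.
move=> Uz; have Fz := F_neq0 Uz.
have dg := is_derive_dy k (gexp_differentiable i j Uz).
have -> : cartan F i j k z = 2^-1 * dy k (gexp i j) z.
  congr (_ * _); apply: dyE; apply: is_derive_open U_open Uz _ dg.
  by move=> w Uw; rewrite gmetE.
have DF := is_derive_dy k (dF Uz).
have := is_derive_inj U_open Uz (gexpE i j)
  (is_derive_mul (is_derive_mul DF DF) dg)
  (is_derive_add
    (is_derive_mul (is_derive_mul DF DF)
      (is_derive_mul (is_derive_dy k (dF1 i Uz)) (is_derive_dy k (dF1 j Uz))))
    (is_derive_mul (is_derive_dy k (detg_differentiable Uz))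
      (is_derive_mul (is_derive_n k i z) (is_derive_n k j z)))).
have := gexpE i j Uz.
have := detg_euler k Uz.
have := dn_perp k i Uz; have := dn_perp k j Uz.
have := hessF Uz k i; have := hessF Uz k j.
(* All values are generalized to scalars, leaving a rational identity under the relations just
   introduced. *)
move: (F1 0 z * _ - _) (dy k detg z) (detg z) (n i z) (n j z) (n k z) (gexp i j z).
move: (dy k (gexp i j) z) (perp _ i) (perp _ j) (F2 k i z) (F2 k j z).
move: (F1 i z) (F1 j z) (F1 k z) (F z) Fz.
move=> fi fj fk L L0 dg' di dj hi hj Q d D ni nj nk g ehj ehi edj edi ed eg e.
have {}ehj : hj = D * nk * nj / L ^+ 3 by rewrite -ehj; field.
have {}ehi : hi = D * nk * ni / L ^+ 3 by rewrite -ehi; field.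
have {}edj : dj = (fk * nj - fj * nk) / L by rewrite -edj; field.
have {}edi : di = (fk * ni - fi * nk) / L by rewrite -edi; field.
have {}ed : d = Q * nk / L by rewrite -ed; field.
have {}eg : g = fi * fj + D * (ni * nj) / L ^+ 2.
  by apply: (mulfI L0); apply: (mulfI L0); rewrite mulrA eg; field.
(* The numerator is made to display the left side of [e] exactly as the product rule wrote it, so
   that [e] can be rewritten. *)
have -> : dg' = ((L * L) * dg' + g * (L * fk + L * fk)
  - g * (L * fk + L * fk)) / L ^+ 2 by field.
by rewrite e ehi ehj edi edj ed eg; field.
Qed.

(** Comparison of [cartanE] with m_i = s n_i / F. The value of [xget] is determined because the
    admissible scalar is unique. *)
Lemma main_scalarE z : U z ->
  main_scalar F z = F z * (F1 0 z * dy 1 detg z - F1 1 z * dy 0 detg z)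
    / (2 * sdet z ^+ 3).
Proof.
move=> Uz; have Fz := F_neq0 Uz; have sz := lt0r_neq0 (sdet_gt0 Uz).
(* If [n] vanished, pairing it with the gradient of F would give F = 0. A nonzero component gives
   uniqueness through the entry [i i i]. *)
have [i ni] : exists i, n i z != 0.
  apply/existsP; rewrite -negb_forall; apply/forallP => /= n0.
  move: Fz; rewrite -(F_euler Uz).
  rewrite -(@perp_pairing _ (fun k => F1 k z) (fun k => z.2 0 k)).
  by rewrite (eqP (n0 0)) (eqP (n0 1)) !mulr0 subrr eqxx.
rewrite /main_scalar; apply: xget_unique => [j k l|c /(_ i i i)];
  rewrite cartanE // !m_loE //.
  move: (_ - _) (n _ z) (n _ z) (n _ z) (F z) Fz (sdet z) sz.
  by move=> Q a b c L L0 s s0; field; exact/andP.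
move: (_ - _) (n i z) ni (F z) Fz (sdet z) sz => Q a a0 L L0 s s0 E.
apply: (mulIf (expf_neq0 3 a0)); apply: (mulIf (expf_neq0 3 s0)).
transitivity (c * (s * a / L) * (s * a / L) * (s * a / L) * L ^+ 3).
  by field.
by rewrite -E; field; exact/andP.
Qed.

(** * Vertical derivatives of phi, and sigma *)

Variable phi : coord -> R.
Hypothesis phi_smooth : smooth_on U phi.
Hypothesis phi_homog : homog U 0 phi.

Let dphi z : U z -> differentiable phi z.
Proof. exact: smooth_on_differentiable. Qed.

Let dphi1 i z : U z -> differentiable (dy i phi) z.
Proof. by apply: smooth_on_differentiable; exact: smooth_on_dy. Qed.

(* [phi_{;2}] multiplied by [sdet]. *)
Definition phi2 z : R := F z * (F1 0 z * dy 1 phi z - F1 1 z * dy 0 phi z).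

Let Q z : R := F1 0 z * dy 1 phi2 z - F1 1 z * dy 0 phi2 z.

Lemma vder2_phi z : U z -> vder2 F phi z = phi2 z / sdet z.
Proof. exact: vder2E. Qed.

Lemma phi2_homog : homog U 0 phi2.
Proof.
move=> z t t0 Uz.
have h i := homog_dy U_open U_dilate i phi_homog dphi t0 Uz.
rewrite /phi2 (F_homog t0 Uz) (F1_homog 0 t0 Uz) (F1_homog 1 t0 Uz) !h.
rewrite sub0r powRr0 powRr1 ?ltW // powR_inv1 ?ltW //.
move: (F z) (F1 0 z) (F1 1 z) (dy 0 phi z) (dy 1 phi z) => a b c d e.
by field; exact: lt0r_neq0.
Qed.

Lemma phi2_differentiable z : U z -> differentiable phi2 z.
Proof.
move=> Uz; apply: differentiableM; first exact: dF.
by apply: differentiableB; apply: differentiableM; auto.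
Qed.

Lemma phi2_euler k z : U z -> F z * dy k phi2 z = Q z * n k z.
Proof. by move=> Uz; apply: euler0 phi2_homog Uz (phi2_differentiable Uz) k. Qed.

Lemma phi1E i z : U z -> F z * F z * dy i phi z = phi2 z * n i z.
Proof.
by move=> Uz; rewrite -mulrA (euler0 phi_homog Uz (dphi Uz)) mulrA.
Qed.

(** [phi1E] is differentiated in direction [i]; the derivative of F^2 reverses the sign of the F_i
    n_j term coming from [n], which makes the result symmetric. *)
Lemma hess_phi i j z : U z -> F z ^+ 2 * dy i (dy j phi) z =
  (Q z * n i z * n j z - phi2 z * (F1 i z * n j z + F1 j z * n i z)) / F z.
Proof.
move=> Uz; have Fz := F_neq0 Uz.
have DF := is_derive_dy i (dF Uz).
have := is_derive_inj U_open Uz (phi1E j)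
  (is_derive_mul (is_derive_mul DF DF) (is_derive_dy i (dphi1 j Uz)))
  (is_derive_mul (is_derive_dy i (phi2_differentiable Uz)) (is_derive_n i j z)).
have := phi2_euler i Uz; have := phi1E j Uz; have := dn_perp i j Uz.
move: (dy j phi z) (dy i (dy j phi) z) (dy i phi2 z) (perp _ j).
move: (phi2 z) (Q z) (n i z) (n j z) (F1 i z) (F1 j z) (F z) Fz.
move=> P q ni nj fi fj L L0 pj pij Pi dj edj epj ePi e.
have {}edj : dj = (fi * nj - fj * ni) / L by rewrite -edj; field.
have {}ePi : Pi = q * ni / L by rewrite -ePi; field.
have {}epj : pj = P * nj / (L * L) by rewrite -epj; field.
have -> : L ^+ 2 * pij = (L * L * pij + pj * (L * fi + L * fi))
  - pj * (L * fi + L * fi) by ring.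
by rewrite e edj ePi epj; field.
Qed.

Let is_derive_sdetV k z : U z -> is_derive z (ey k) (fun w => (sdet w)^-1)
  (- dy k detg z / (2 * detg z * sdet z)).
Proof.
move=> Uz; apply: is_derive_inv_sqrt_norm; first exact: detg_neq0.
exact: is_derive_dy (detg_differentiable Uz).
Qed.

Lemma sigmaE z : U z ->
  sigma F phi z = (F z * Q z + 2 * phi2 z ^+ 2) / sdet z ^+ 2.
Proof.
move=> Uz; have Fz := F_neq0 Uz; have Dz := detg_neq0 Uz.
have sz := lt0r_neq0 (sdet_gt0 Uz).
pose E := F1 0 z * dy 1 detg z - F1 1 z * dy 0 detg z.
(* The coefficient of [n] in F times the vertical gradient of [phi2 / sdet]; its second term comes
   from differentiating 1 / [sdet]. *)
pose c := Q z / sdet z - phi2 z * E / (2 * detg z * sdet z).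
have dp k : dy k (vder2 F phi) z = c * n k z / F z.
  have := is_derive_mul (is_derive_dy k (phi2_differentiable Uz))
    (is_derive_sdetV k Uz).
  move=> /(is_derive_open U_open Uz (fun w Uw => esym (vder2_phi Uw)))/dyE ->.
  have := phi2_euler k Uz; have := detg_euler k Uz; rewrite /c -/E.
  move: E (Q z) (phi2 z) (n k z) (dy k phi2 z) (dy k detg z) {c} => E q P nk Pk Dk.
  move: (F z) Fz (detg z) Dz (sdet z) sz => L L0 D D0 s s0 ED EP.
  have -> : Dk = E * nk / L by rewrite -ED; field.
  have -> : Pk = q * nk / L by rewrite -EP; field.
  by field; rewrite L0 D0 s0.
have cE : F1 0 z * dy 1 (vder2 F phi) z - F1 1 z * dy 0 (vder2 F phi) z = c.
  have := @perp_pairing _ (fun k => F1 k z) (fun k => z.2 0 k).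
  rewrite !dp (F_euler Uz).
  move: (F1 0 z) (F1 1 z) (n 0 z) (n 1 z) (F z) Fz c {dp} => a b u v L L0 x e.
  by transitivity (x * (a * v - b * u) / L); [ring|rewrite e mulfK].
rewrite /sigma vder2_phi // vder2E // cE main_scalarE // /c -/E.
have := signature_sqr Uz; rewrite (detg_sdet Uz) in Dz *.
have e0 : signature F z != 0 by move: Dz; rewrite mulf_eq0 negb_or => /andP[].
move: E (Q z) (phi2 z) (F z) (signature F z) e0 (sdet z) sz {c dp cE Dz Fz}.
move=> E q P L e e0 s s0 e2.
(* The main scalar term gets the factor 1 / e, matching det g = e s^2 in the denominator of [c], so
   that the two cancel. *)
have -> : e * (L * E / (2 * s ^+ 3)) = e ^+ 2 * (L * E / (2 * s ^+ 3)) / e.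
  by field; rewrite e0 s0.
by rewrite e2; field; rewrite e0 s0.
Qed.

(** The mixed terms F_i n_j appear once from the product of first derivatives and once from the
    second derivatives of e^phi F; the Hessian of phi cancels one copy. *)
Lemma gmet_conformal i j z : U z ->
  gmet (fun w => expR (phi w) * F w) z i j =
    expR (phi z) ^+ 2 * F1 i z * F1 j z
    + expR (phi z) ^+ 2 * phi2 z / F z * (F1 i z * n j z + F1 j z * n i z)
    + expR (phi z) ^+ 2 * (2 * phi2 z ^+ 2 + F z * Q z + detg z) / F z ^+ 2
      * n i z * n j z.
Proof.
move=> Uz; have Fz := F_neq0 Uz.
have dexp k w : U w ->
    is_derive w (ey k) (fun w => expR (phi w)) (expR (phi w) * dy k phi w).
  move=> Uw.
  exact: is_derive_scalar_comp (is_derive_expR _) (is_derive_dy k (dphi Uw)).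
have dG k w (Uw : U w) := is_derive_mul (dexp k w Uw) (is_derive_dy k (dF Uw)).
have ddG k l := is_derive_add
  (is_derive_mul (dexp k z Uz) (is_derive_dy k (dF1 l Uz)))
  (is_derive_mul (is_derive_dy k (dF Uz))
     (is_derive_mul (dexp k z Uz) (is_derive_dy k (dphi1 l Uz)))).
rewrite (gmet_derive U_open Uz dG ddG).
have := phi1E i Uz; have := phi1E j Uz; have := hess_phi i j Uz.
have := hessF Uz i j.
move: (dy i phi z) (dy j phi z) (dy i (dy j phi) z) (F2 i j z) (expR (phi z)).
move: (phi2 z) (Q z) (n i z) (n j z) (F1 i z) (F1 j z) (detg z) (F z) Fz.
move=> P q ni nj fi fj D L L0 pi pj pij Fij x eF epij epj epi.
have -> : pi = P * ni / (L * L) by rewrite -epi; field.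
have -> : pj = P * nj / (L * L) by rewrite -epj; field.
have -> : Fij = D * ni * nj / L ^+ 3 by rewrite -eF; field.
have -> : pij = (q * ni * nj - P * (fi * nj + fj * ni)) / L / L ^+ 2.
  by rewrite -epij; field.
by field.
Qed.

(** [frame_invmx] inverts the form of [gmet_conformal], and [conformal_inverse_algebra] rewrites the
    result in the Berwald frame. *)
Lemma ginv_conformal z (eps := signature F z) (p := vder2 F phi z)
    (s := sigma F phi z) (r := rho F phi z) (g := ginv F z)
    (l := fun i => l_up F i z) (m := fun i => m_up F i z)
    (Fbar := fun w => expR (phi w) * F w) :
  U z -> rho_denom F phi z != 0 ->
  gmet Fbar z \in unitmx /\
  forall i j : 'I_2,
    ginv Fbar z i j =
      expR (- 2 * phi z) *
      (eps * r * g i j + s * r * l i * l j - eps * p * r * (l i * m j + l j * m i)) /\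
    ginv Fbar z i j =
      expR (- 2 * phi z) *
      (g i j + p ^+ 2 * r * l i * l j - eps * p * r * (l i * m j + l j * m i)
       + (r - eps) * m i * m j).
Proof.
move=> Uz d0; have Fz := F_neq0 Uz; have Dz := detg_neq0 Uz.
have sz := lt0r_neq0 (sdet_gt0 Uz).
have e2 : eps ^+ 2 = 1 by exact: signature_sqr.
have De : detg z = eps * sdet z ^+ 2 by exact: detg_sdet.
have e0 : eps != 0 by rewrite -sqrf_eq0 e2 oner_neq0.
have x0 : expR (phi z) != 0 by rewrite gt_eqF // expR_gt0.
have pE : phi2 z = p * sdet z by rewrite /p vder2_phi // divfK.
(* [sigmaE] solved for F Q, with P = p s inserted. *)
have sE : F z * Q z = (s - 2 * p ^+ 2) * sdet z ^+ 2.
  rewrite /s sigmaE // mulrBl divfK ?expf_neq0 // pE exprMn.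
  by rewrite mulrA addrK.
have dE : rho_denom F phi z = s + eps - p ^+ 2 by [].
have rE : r = 1 / (s + eps - p ^+ 2) by [].
have epsE : signature F z = eps by [].
have gE := fun i j => ginvE i j Uz : g i j = _.
have mE := fun i => m_upE i Uz : m i = _.
have lE i : l i = z.2 0 i / F z by [].
rewrite epsE De in mE gE.
clearbody r s p eps g m l; rewrite dE in d0.
(* The discriminant a c - b^2 of the form: 1 / rho enters here, and its nonvanishing is what makes
   the form invertible. *)
have acb : expR (phi z) ^+ 2 *
    (expR (phi z) ^+ 2 * (2 * phi2 z ^+ 2 + F z * Q z + detg z) / F z ^+ 2)
  - (expR (phi z) ^+ 2 * phi2 z / F z) ^+ 2
  = expR (phi z) ^+ 4 * sdet z ^+ 2 * (s + eps - p ^+ 2) / F z ^+ 2.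
  rewrite pE sE De; move: (F z) Fz (sdet z) (expR (phi z)) => L L0 S x.
  by field.
have := @frame_invmx _ (fun i => F1 i z) (fun i => z.2 0 i) _ _ _ _ _ _
  (fun i j => gmet_conformal i j Uz).
rewrite (F_euler Uz) acb => -[] //.
  by rewrite !mulf_neq0 ?invr_eq0 ?expf_neq0.
move=> unit_gbar inv_gbar; split=> // i j.
have -> : expR (- 2 * phi z) = (expR (phi z) ^+ 2)^-1.
  by rewrite mulNr expRN -expRM_natl.
have -> : ginv Fbar z i j = _ := inv_gbar i j.
rewrite gE !mE !lE pE sE De rE.
exact: conformal_inverse_algebra.
Qed.

End BerwaldFrame.

(** * From induced coordinates to the surface *)

Theorem proposition2p13 (R : realType) (M : smoothSurface R)
    (A : set (tangent M)) (F phi : tangent M -> R)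
    (hF : conic_pseudo_Finsler A F)
    (phi_smooth : TM_smooth A phi)
    (phi_homogeneous : homogeneous A 0 phi)
    (hrho : forall (c : chart_index M) z, local_set A c z ->
      rho_denom (local_fun F c) (local_fun phi c) z != 0) :
  forall (c : chart_index M) z, local_set A c z ->
    let Fc := local_fun F c in
    let phic := local_fun phi c in
    let Fbar := local_fun (fun u => expR (phi u) * F u) c in
    let eps := signature Fc z in
    let p2 := vder2 Fc phic z in
    let s := sigma Fc phic z in
    let r := rho Fc phic z in
    let g i j := ginv Fc z i j in
    let l i := l_up Fc i z in
    let m i := m_up Fc i z in
    gmet Fbar z \in unitmx /\
    forall i j : 'I_2,
      ginv Fbar z i j =
        expR (- 2 * phic z) *
        (eps * r * g i j + s * r * l i * l j
         - eps * p2 * r * (l i * m j + l j * m i)) /\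
      ginv Fbar z i j =
        expR (- 2 * phic z) *
        (g i j + p2 ^+ 2 * r * l i * l j
         - eps * p2 * r * (l i * m j + l j * m i)
         + (r - eps) * m i * m j).
Proof.
move=> c z Az; have [[_ _ A_open _ A_scale] F_smooth F_homog F_nondeg F_neq0] := hF.
have U_dilate : forall w t, 0 < t -> local_set A c w -> local_set A c (dilate t w).
  by move=> [x y] t t0; exact: A_scale.
have cF_homog : homog (local_set A c) 1 (local_fun F c).
  by move=> [x y] t; exact: F_homog.
have cphi_homog : homog (local_set A c) 0 (local_fun phi c).
  by move=> [x y] t; exact: phi_homogeneous.
have cF_neq0 w : local_set A c w -> local_fun F c w != 0.
  by move=> [_ Aw]; exact: F_neq0.
have cF_nondeg w : local_set A c w -> \det (gmet (local_fun F c) w) != 0.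
  exact: F_nondeg.
(* The expression of e^phi F in the chart unfolds to the product of the local expressions, so the
   coordinate result applies on [local_set A c]. *)
exact: (ginv_conformal (A_open c) U_dilate (F_smooth c) cF_homog cF_neq0
  cF_nondeg (phi_smooth c) cphi_homog Az (hrho c z Az)).
Qed.
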